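(* Let $E$ be a relatively uniformly complete Riesz space. Then for every $x\in E$ such that the principal ideal $A_{|x|}$ is infinite dimensional, there exists a disjointness preserving linear functional $\phi:E\to\mathbb{R}$ which is not order bounded and satisfies $\phi(x)=1$.
   Context: A Riesz space is a real vector lattice. $E$ is relatively uniformly complete if for every $0\le u\in E$, every $u$-uniformly Cauchy sequence in $E$ converges $u$-uniformly to an element of $E$; here $(x_n)$ is $u$-uniformly Cauchy if for every $\varepsilon>0$ there is $N$ with $|x_n-x_m|\le\varepsilon u$ for all $n,m\ge N$, and $x_n\to x$ $u$-uniformly if for every $\varepsilon>0$ there is $N$ with $|x_n-x|\le \varepsilon u$ for all $n\ge N$. For $0\le u\in E$, $A_u=\{y\in E: |y|\le\lambda u \text{ for some } \lambda\ge 0\}$ is the principal ideal generated by $u$. Elements $x,y$ are disjoint, $x\perp y$, if $|x|\wedge|y|=0$. A linear functional $\phi:E\to\mathbb{R}$ is disjointness preserving if $x\perp y$ implies $\phi(x)\phi(y)=0$. It is order bounded if it maps order intervals of $E$ to bounded subsets of $\mathbb{R}$. *)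

(* Defs.v *)
From HB Require Import structures.
From mathcomp Require Import all_boot all_order all_algebra.
From mathcomp Require Import all_classical all_reals all_analysis.
Import Order.TTheory GRing.Theory Num.Theory.

Set Implicit Arguments.
Unset Strict Implicit.
Unset Printing Implicit Defensive.

Local Open Scope classical_set_scope.
Local Open Scope ring_scope.

(* The lattice operations are fields, specified as in
   [Order.POrder_isMeetSemilattice] and [Order.POrder_isJoinSemilattice],
   because HB refuses to join [GRing.Lmodule] with [Order.Lattice]:
   [Num.RealDomain] inherits from both zmodules and lattices, and MathComp has
   no structure of lattice-ordered zmodules above it. *)
HB.mixin Record isRiesz (R : realType) E
    of GRing.Lmodule R E & Num.POrderedZmodule E := {
  rmeet : E -> E -> E;
  rjoin : E -> E -> E;
  rmeetP : forall x y z : E, (z <= rmeet x y) = (z <= x) && (z <= y);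
  rjoinP : forall x y z : E, (rjoin x y <= z) = (x <= z) && (y <= z);
  rieszD2r : forall z x y : E, x <= y -> x + z <= y + z;
  rieszZ_ge0 : forall (a : R) (x : E), 0 <= a -> 0 <= x -> 0 <= a *: x
}.

#[short(type="rieszType")]
HB.structure Definition Riesz (R : realType) :=
  { E of GRing.Lmodule R E & Num.POrderedZmodule E & isRiesz R E }.

Definition rabs (R : realType) (E : rieszType R) (x : E) : E := rjoin x (- x).

Definition rdisjoint (R : realType) (E : rieszType R) (x y : E) : Prop :=
  rmeet (rabs x) (rabs y) = 0.

Definition unif_cauchy (R : realType) (E : rieszType R) (u : E)
    (x : nat -> E) : Prop :=
  forall e : R, 0 < e -> exists N : nat, forall n m : nat,
    (N <= n)%N -> (N <= m)%N -> rabs (x n - x m) <= e *: u.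

Definition unif_cvg (R : realType) (E : rieszType R) (u : E)
    (x : nat -> E) (l : E) : Prop :=
  forall e : R, 0 < e -> exists N : nat, forall n : nat,
    (N <= n)%N -> rabs (x n - l) <= e *: u.

Definition unif_complete (R : realType) (E : rieszType R) : Prop :=
  forall u : E, 0 <= u -> forall x : nat -> E,
    unif_cauchy u x -> exists l : E, unif_cvg u x l.

Definition principal_ideal (R : realType) (E : rieszType R) (u : E) : set E :=
  [set y | exists2 a : R, 0 <= a & rabs y <= a *: u].

(* To be used on linear subspaces [A] only. *)
Definition finite_dimensional (R : realType) (E : lmodType R) (A : set E) :
    Prop :=
  exists (n : nat) (v : 'I_n -> E), (forall i, A (v i)) /\
    forall y, A y -> exists c : 'I_n -> R, y = \sum_(i < n) c i *: v i.

Definition disjointness_preserving (R : realType) (E : rieszType R)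
    (phi : E -> R) : Prop :=
  forall x y : E, rdisjoint x y -> phi x * phi y = 0.

Definition order_bounded (R : realType) (E : rieszType R) (phi : E -> R) :
    Prop :=
  forall a b : E, bounded_set (phi @` `[a, b] : set R^o).

(* Main.v *)
From HB Require Import structures.
Require Import Defs.
From mathcomp Require Import all_boot all_order all_algebra.
From mathcomp Require Import all_classical all_reals all_analysis.
Import Order.TTheory GRing.Theory Num.Theory.

(** Put [u = |x|]. Suppose that some [y >= 0] satisfies [y <= c (c y - u)^+]
    for no [c >= 0]. Then [y] lies outside the ideal generated by the elements
    [(c y - u)^+]; an ideal [P] containing them and maximal among those avoiding
    [y] is prime. Modulo [P] all multiples of [y] are below [u], so [x] and [y]
    are linearly independent and a linear functional vanishing on [P] can take
    the value [1] at both. It preserves disjointness because [P] is prime, and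
    its value at [c y /\ u = c y - (c y - u)^+], which lies in [[0, u]], is [c].

    Suppose now that there is no such [y] (this is how the non-Archimedean case
    is disposed of: [A_u] is then Archimedean). Every element of [A_u] generates
    a component of [u], so if [A_u] is infinite dimensional, splitting
    components repeatedly gives nonzero disjoint elements [e_n] of [[0, u]].
    Uniform completeness provides [g = \sum_n 2^-n e_n], and [g] satisfies
    no inequality [g <= c (c g - u)^+]: on [e_n] with [2^n >= c] the right-hand
    side vanishes. *)

Local Open Scope ring_scope.

(** * Positive parts, absolute values and disjointness in a Riesz space *)

Section Riesz.
Set Implicit Arguments.
Unset Strict Implicit.
Context {R : realType} {E : rieszType R}.
Implicit Types (x y z t u v w : E) (a b c : R).

Lemma rmeet_lel x y : rmeet x y <= x.
Proof. by have := lexx (rmeet x y); rewrite rmeetP => /andP[]. Qed.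

Lemma rmeet_ler x y : rmeet x y <= y.
Proof. by have := lexx (rmeet x y); rewrite rmeetP => /andP[]. Qed.

Lemma rjoin_gel x y : x <= rjoin x y.
Proof. by have := lexx (rjoin x y); rewrite rjoinP => /andP[]. Qed.

Lemma rjoin_ger x y : y <= rjoin x y.
Proof. by have := lexx (rjoin x y); rewrite rjoinP => /andP[]. Qed.

Lemma rmeetC x y : rmeet x y = rmeet y x.
Proof. by apply/le_anti; rewrite !rmeetP !rmeet_lel !rmeet_ler. Qed.

Lemma rieszD x y z t : x <= y -> z <= t -> x + z <= y + t.
Proof.
move=> xy zt; apply: (le_trans (rieszD2r z _ _ xy)).
by rewrite ![y + _]addrC; exact: rieszD2r.
Qed.

Lemma rieszBlDr x y z : (x - y <= z) = (x <= z + y).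
Proof.
by apply/idP/idP => /(fun h z => rieszD2r z _ _ h) h;
  [have := h y | have := h (- y)];
  rewrite ?subrK ?addrK.
Qed.

Lemma riesz_subr_ge0 x y : (0 <= y - x) = (x <= y).
Proof.
by apply/idP/idP => /(fun h z => rieszD2r z _ _ h) h;
  [have := h x | have := h (- x)];
  rewrite ?subrK ?addrK ?subrr ?add0r.
Qed.

Lemma riesz_addr_ge0 x y : 0 <= x -> 0 <= y -> 0 <= x + y.
Proof. by move=> x0 /(rieszD x0); rewrite addr0. Qed.

Lemma riesz_lerDl x y : 0 <= y -> x <= x + y.
Proof. by move=> /(rieszD (lexx x)); rewrite addr0. Qed.

Lemma riesz_lerDr x y : 0 <= y -> x <= y + x.
Proof. by rewrite addrC; exact: riesz_lerDl. Qed.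

Lemma rieszN2 x y : (- x <= - y) = (y <= x).
Proof. by rewrite -[LHS]riesz_subr_ge0 opprK addrC riesz_subr_ge0. Qed.

Lemma rieszN_le0 x : (- x <= 0) = (0 <= x).
Proof. by rewrite -{1}oppr0 rieszN2. Qed.

Lemma rieszZ a x y : 0 <= a -> x <= y -> a *: x <= a *: y.
Proof.
move=> a0; rewrite -riesz_subr_ge0 => /(rieszZ_ge0 _ _ a0).
by rewrite scalerBr riesz_subr_ge0.
Qed.

Lemma rieszZr a b x : 0 <= x -> a <= b -> a *: x <= b *: x.
Proof.
move=> x0 ab; rewrite -riesz_subr_ge0 -scalerBl.
by apply: rieszZ_ge0; rewrite ?subr_ge0.
Qed.

Lemma rieszZ_inv a x y : 0 < a -> a *: x <= a *: y -> x <= y.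
Proof.
move=> a0 /(@rieszZ a^-1 _ _); rewrite !scalerA mulVf ?gt_eqF// !scale1r.
by apply; rewrite invr_ge0 ltW.
Qed.

Lemma rjoinDr x y z : rjoin (x + z) (y + z) = rjoin x y + z.
Proof.
apply/le_anti/andP; split.
  by rewrite rjoinP; apply/andP; split; apply: rieszD2r;
    rewrite ?rjoin_gel ?rjoin_ger.
rewrite -[leRHS](subrK z) -[- z in leRHS]opprK; apply: rieszD2r.
rewrite opprK rjoinP; apply/andP.
by split; rewrite -[leLHS](addrK z); apply: rieszD2r;
  rewrite ?rjoin_gel ?rjoin_ger.
Qed.

Definition rpos x : E := rjoin x 0.

Lemma rpos_ge0 x : 0 <= rpos x. Proof. exact: rjoin_ger. Qed.

Lemma rpos_ge x : x <= rpos x. Proof. exact: rjoin_gel. Qed.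

Lemma rpos_le x y : (rpos x <= y) = (x <= y) && (0 <= y).
Proof. exact: rjoinP. Qed.

Lemma ge0_rpos x : 0 <= x -> rpos x = x.
Proof. by move=> x0; apply/le_anti; rewrite rpos_ge rpos_le x0 lexx. Qed.

Lemma le0_rpos x : x <= 0 -> rpos x = 0.
Proof. by move=> x0; apply/le_anti; rewrite rpos_ge0 rpos_le x0 lexx. Qed.

Lemma rpos_mono x y : x <= y -> rpos x <= rpos y.
Proof. by move=> xy; rewrite rpos_le rpos_ge0 (le_trans xy) ?rpos_ge. Qed.

Lemma rposZ a x : 0 <= a -> rpos (a *: x) = a *: rpos x.
Proof.
rewrite le_eqVlt => /predU1P[<-|a0]; first by rewrite !scale0r ge0_rpos.
have a0' := ltW a0; apply/le_anti/andP; split.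
  by rewrite rpos_le rieszZ_ge0 ?rpos_ge0// rieszZ ?rpos_ge.
have : rpos x <= a^-1 *: rpos (a *: x).
  rewrite rpos_le rieszZ_ge0 ?rpos_ge0 ?invr_ge0// andbT.
  apply: (rieszZ_inv a0); rewrite scalerA mulfV ?gt_eqF// scale1r.
  exact: rpos_ge.
by move=> /(rieszZ a0'); rewrite scalerA mulfV ?gt_eqF// scale1r.
Qed.

Lemma rposB x : rpos x - rpos (- x) = x.
Proof.
suff -> : rpos (- x) = rpos x - x by rewrite opprB addrC subrK.
rewrite /rpos -rjoinDr subrr add0r.
by apply/le_anti; rewrite !rjoinP !rjoin_gel !rjoin_ger.
Qed.

Lemma rmeetE x y : rmeet x y = x - rpos (x - y).
Proof.
apply/le_anti/andP; split.
  rewrite -rieszN2 opprB rieszBlDr rpos_le [- _ + x]addrC.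
  rewrite riesz_subr_ge0 rmeet_lel andbT.
  by apply: rieszD => //; rewrite rieszN2 rmeet_ler.
rewrite rmeetP; apply/andP; split; rewrite rieszBlDr.
  exact: riesz_lerDl (rpos_ge0 _).
by rewrite addrC -rieszBlDr rpos_ge.
Qed.

Lemma rpos_meetN x : rmeet (rpos x) (rpos (- x)) = 0.
Proof. by rewrite rmeetE rposB subrr. Qed.

Lemma rabsE x : rabs x = rpos x + rpos (- x).
Proof.
have -> : rpos (- x) = rpos x - x by rewrite -{3}[x]rposB opprB addrC subrK.
(* Translating the join by [x] gives [|x| + x = (2 x) \/ 0 = 2 x^+]. *)
rewrite addrA -mulr2n -scaler_nat -rposZ ?ler0n// /rpos -rjoinDr scaler_nat.
by rewrite mulr2n addrK add0r.
Qed.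

Lemma rabs_le x y : (rabs x <= y) = (x <= y) && (- x <= y).
Proof. exact: rjoinP. Qed.

Lemma rabs_ge x : x <= rabs x. Proof. exact: rjoin_gel. Qed.

Lemma rabs_geN x : - x <= rabs x. Proof. exact: rjoin_ger. Qed.

Lemma rabs_ge0 x : 0 <= rabs x.
Proof. by rewrite rabsE riesz_addr_ge0 ?rpos_ge0. Qed.

Lemma ge0_rabs x : 0 <= x -> rabs x = x.
Proof. by move=> x0; rewrite rabsE ge0_rpos ?le0_rpos ?rieszN_le0 ?addr0. Qed.

Lemma rabsN x : rabs (- x) = rabs x.
Proof. by rewrite !rabsE opprK addrC. Qed.

Lemma rabsD x y : rabs (x + y) <= rabs x + rabs y.
Proof. by rewrite rabs_le opprD !rieszD ?rabs_ge ?rabs_geN. Qed.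

Lemma rabsZ a x : rabs (a *: x) = `|a| *: rabs x.
Proof.
wlog a0 : a / 0 <= a => [hwlog|].
  have [/hwlog//|/ltW a0] := leP 0 a.
  by rewrite -rabsN -scaleNr hwlog ?oppr_ge0// normrN.
by rewrite !rabsE -scalerN !rposZ// ger0_norm// scalerDr.
Qed.

Lemma rpos_le_rabs x : rpos x <= rabs x.
Proof. by rewrite rabsE riesz_lerDl ?rpos_ge0. Qed.

Lemma rmeet_eq0P x y : 0 <= x -> 0 <= y ->
  (forall w, 0 <= w -> w <= x -> w <= y -> w <= 0) -> rmeet x y = 0.
Proof.
move=> x0 y0 h; have m0 : 0 <= rmeet x y by rewrite rmeetP x0.
by apply/le_anti; rewrite m0 h ?rmeet_lel ?rmeet_ler.
Qed.

Lemma rmeet0_le x y w : rmeet x y = 0 -> w <= x -> w <= y -> w <= 0.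
Proof. by move=> <- wx wy; rewrite rmeetP wx. Qed.

(** The element [w - z] lies below both [x] and [y], hence below their meet [0]. *)
Lemma rmeet0_leD x y z w :
  rmeet x y = 0 -> 0 <= z -> w <= x -> w <= y + z -> w <= z.
Proof.
move=> xy z0 wx wyz; rewrite -[z]add0r -rieszBlDr.
apply: (rmeet0_le xy); rewrite rieszBlDr//.
by apply: (le_trans wx); exact: riesz_lerDl.
Qed.

Lemma rmeet0_sub x y z t : rmeet x y = 0 -> 0 <= z -> 0 <= t ->
  z <= x -> t <= y -> rmeet z t = 0.
Proof.
move=> xy z0 t0 zx ty; apply: rmeet_eq0P => // w _ wz wt.
by apply: (rmeet0_le xy); [exact: le_trans zx|exact: le_trans ty].
Qed.

Lemma rmeet0D x y z : 0 <= x -> 0 <= y -> 0 <= z ->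
  rmeet x y = 0 -> rmeet x z = 0 -> rmeet x (y + z) = 0.
Proof.
move=> x0 y0 z0 xy xz; apply: rmeet_eq0P => //; first exact: riesz_addr_ge0.
move=> w _ wx wyz; apply: (rmeet0_le xz) => //.
exact: (rmeet0_leD xy).
Qed.

Lemma rmeet0Z a x y : 0 <= a -> 0 <= x -> 0 <= y ->
  rmeet x y = 0 -> rmeet x (a *: y) = 0.
Proof.
move=> a0 x0 y0 xy; apply: rmeet_eq0P => //; first exact: rieszZ_ge0.
move=> w w0 wx wy; have s0 : 0 < 1 + a by rewrite ltr_wpDr.
(* Dividing by [1 + a] rather than by [a] keeps the quotient below [x] as well as below [y], and
   allows [a = 0]. *)
suff : (1 + a)^-1 *: w <= 0.
  move=> h; apply: (@rieszZ_inv (1 + a)^-1); rewrite ?invr_gt0// scaler0//.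
apply: (rmeet0_le xy).
  apply: le_trans wx; rewrite -[leRHS]scale1r rieszZr// invf_le1//.
  by rewrite lerDl.
apply: (rieszZ_inv s0); rewrite scalerA mulfV ?gt_eqF// scale1r.
by apply: (le_trans wy); rewrite rieszZr// lerDr.
Qed.

End Riesz.

(** * Maximal sets avoiding a point *)

Section Zorn.
Local Open Scope classical_set_scope.
Set Implicit Arguments.
Unset Strict Implicit.

(** Applied to subspaces, this yields a functional; applied to ideals, a prime ideal. *)
Lemma maximal_avoiding (T : Type) (Q : set (set T)) (S : set T) (t : T) :
  (forall F : set (set T), F !=set0 -> F `<=` Q -> total_on F subset ->
    Q (\bigcup_(X in F) X)) ->
  Q S -> ~ S t ->
  exists A, [/\ S `<=` A, Q A, ~ A t &
    forall B, Q B -> A `<=` B -> ~ B t -> B `<=` A].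
Proof.
move=> Qchain QS St.
(* Zorn's lemma also asks about the empty chain, whose union need not satisfy [Q]. Hence [S] is
   united to every set, and it joins the chain itself so that [Qchain] receives a nonempty
   family. *)
pose P (A : set T) := Q (A `|` S) /\ ~ (A `|` S) t.
have [F FP Ftot|A [[QA At] Amax]] := @Zorn_bigcup T P.
  have -> : P (\bigcup_(X in F) X) =
      (Q (\bigcup_(X in S |` [set X `|` S | X in F]) X) /\
       ~ (\bigcup_(X in S |` [set X `|` S | X in F]) X) t).
    rewrite /P; suff -> : \bigcup_(X in F) X `|` S =
      \bigcup_(X in S |` [set X `|` S | X in F]) X by [].
    apply/seteqP; split=> [z [[X FX Xz]|Sz]|z [_ [->|[X FX <-]]]].
    - by exists (X `|` S); [right; exists X|left].
    - by exists S; [left|].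
    - by right.
    - by move=> [Xz|Sz]; [left; exists X|right].
  split; last by move=> [_ [->//|[X FX <-]]]; exact: (FP X FX).2.
  apply: Qchain; first by exists S; left.
    by move=> _ [->//|[X FX <-]]; exact: (FP X FX).1.
  move=> _ _ [->|[X FX <-]] [->|[Y FY <-]].
  - by left.
  - by left=> z; right.
  - by right=> z; right.
  - by have [XY|YX] := Ftot X Y FX FY; [left|right]; exact: setSU.
exists (A `|` S); split => // B QB AB Bt.
have BS : B `|` S = B by apply/setUidPl => s Ss; apply: AB; right.
apply: contrapT => BA; apply: (Amax B); last by rewrite /P BS.
by split=> [a Aa|BA']; [apply: AB; left|apply: BA => b /BA'; left].
Qed.

End Zorn.

(** * Linear functionals vanishing on a subspace *)

Section Functional.
Local Open Scope classical_set_scope.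
Context {R : realType} {E : lmodType R}.
Set Implicit Arguments.
Unset Strict Implicit.
Implicit Types (A P W : set E) (x y : E).

Definition is_subspace A :=
  A 0 /\ forall (c : R) x y, A x -> A y -> A (c *: x + y).

Lemma is_subspaceZ A (c : R) x : is_subspace A -> A x -> A (c *: x).
Proof. by move=> [A0 AD] Ax; rewrite -[_ *: _]addr0; exact: AD. Qed.

Lemma is_subspaceD A x y : is_subspace A -> A x -> A y -> A (x + y).
Proof. by move=> [A0 AD] Ax Ay; rewrite -[x]scale1r; exact: AD. Qed.

Lemma is_subspace_bigcup (F : set (set E)) :
  F !=set0 -> F `<=` is_subspace -> total_on F subset ->
  is_subspace (\bigcup_(X in F) X).
Proof.
move=> [X FX] Fsub Ftot; split; first by exists X => //; case: (Fsub _ FX).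
move=> c x y [Y FY Yx] [Z FZ Zy].
have [YZ|ZY] := Ftot _ _ FY FZ.
  by exists Z => //; apply: (Fsub _ FZ).2 => //; exact: YZ.
by exists Y => //; apply: (Fsub _ FY).2 => //; exact: ZY.
Qed.

Definition adjoin A x := [set y | exists c : R, A (y - c *: x)].

Lemma is_subspace_adjoin A x : is_subspace A -> is_subspace (adjoin A x).
Proof.
move=> Asub; split=> [|c y z [b Ay] [d Az]].
  by exists 0; rewrite scale0r subr0; exact: Asub.1.
exists (c * b + d); have := Asub.2 c _ _ Ay Az.
by rewrite scalerBr scalerA scalerDl opprD addrACA.
Qed.

Lemma adjoin_sub A x : A `<=` adjoin A x.
Proof. by move=> y Ay; exists 0; rewrite scale0r subr0. Qed.

Lemma adjoin_mem A x : is_subspace A -> adjoin A x x.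
Proof. by move=> [A0 _]; exists 1; rewrite scale1r subrr. Qed.

(** A subspace [W] containing [A] and maximal among those avoiding [x] is a complement of the line
    through [x]: for [y] outside [W], maximality gives [x - b y] in [W] with [b] nonzero. The
    functional reads off the coefficient of [x]. *)
Lemma exists_scalar_vanishing A x : is_subspace A -> ~ A x ->
  exists phi : {scalar E}, phi x = 1 /\ forall y, A y -> phi y = 0.
Proof.
move=> Asub Ax.
have [W [AW Wsub Wx Wmax]] := maximal_avoiding is_subspace_bigcup Asub Ax.
have decomp y : exists c : R, W (y - c *: x).
  have [Wy|Wy] := pselect (W y); first by exists 0; rewrite scale0r subr0.
  pose B := adjoin W y; have Bsub := is_subspace_adjoin y Wsub.
  have [[b Wxby]|Bx] := pselect (B x); last first.
    exfalso; apply: Wy; apply: (Wmax B) => //.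
      exact: adjoin_sub.
    exact: adjoin_mem.
  have b0 : b != 0 by apply/eqP => b0; move: Wxby; rewrite b0 scale0r subr0.
  exists b^-1; have := is_subspaceZ (- b^-1) Wsub Wxby.
  by rewrite scalerBr scalerA mulNr mulVf// !scaleNr scale1r opprK addrC.
have [phi phiP] := choice decomp.
have phiE y c : W (y - c *: x) -> phi y = c.
  move=> Wc; apply/eqP; rewrite -subr_eq0; apply/eqP.
  apply: contrapT => /eqP d0.
  apply: Wx; rewrite -[x]scale1r -(mulVf d0) -scalerA.
  apply: is_subspaceZ => //; have := Wsub.2 (-1) _ _ (phiP y) Wc.
  by rewrite scaleN1r opprB addrA subrK scalerBl.
have lin : linear_for *%R phi.
  move=> c y z; apply: phiE; have := Wsub.2 c _ _ (phiP y) (phiP z).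
  by rewrite scalerBr scalerA addrACA -opprD -scalerDl.
pose L := GRing.isLinear.Build R E R *%R phi lin.
pose psi : {scalar E} := HB.pack phi L.
exists psi; split => /= [|y Ay]; apply: phiE.
  by rewrite scale1r subrr; exact: Wsub.1.
by rewrite scale0r subr0; exact: AW.
Qed.

End Functional.

(** * Prime ideals and the functional they provide *)

Section Ideal.
Local Open Scope classical_set_scope.
Context {R : realType} {E : rieszType R}.
Set Implicit Arguments.
Unset Strict Implicit.
Implicit Types (A B P : set E) (u x y z : E) (a b c d : R).

Definition is_ideal A :=
  is_subspace A /\ forall x y, A y -> rabs x <= rabs y -> A x.

Lemma is_ideal_rabs A x : is_ideal A -> A (rabs x) <-> A x.
Proof.
move=> [_ Asolid].
by split=> /Asolid; apply; rewrite [rabs (rabs x)]ge0_rabs ?rabs_ge0.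
Qed.

Lemma is_ideal_le A x y : is_ideal A -> A y -> rabs x <= y -> A x.
Proof.
by move=> [_ Asolid] /Asolid Ay xy; apply: Ay; apply: le_trans xy (rabs_ge _).
Qed.

Lemma is_ideal_bigcup (F : set (set E)) :
  F !=set0 -> F `<=` is_ideal -> total_on F subset ->
  is_ideal (\bigcup_(X in F) X).
Proof.
move=> F0 Fid Ftot; split.
  by apply: is_subspace_bigcup => // X /Fid [].
move=> x y [X FX Xy] xy; exists X => //.
by apply: (Fid _ FX).2 xy.
Qed.

(** This set is the ideal generated by [P] and [x]. *)
Lemma is_ideal_adjoin P x : is_ideal P ->
  is_ideal [set y | exists p c, [/\ P p, 0 <= p, 0 <= c &
    rabs y <= p + c *: rabs x]].
Proof.
move=> Pid; split; first split.
- exists 0, 0; rewrite lexx scale0r addr0 ge0_rabs//; split=> //.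
  exact: Pid.1.1.
- move=> a y z [p [c [Pp p0 c0 yp]]] [q [d [Pq q0 d0 zq]]].
  exists (`|a| *: p + q), (`|a| * c + d); split.
  + exact: Pid.1.2.
  + by rewrite riesz_addr_ge0 ?rieszZ_ge0.
  + by rewrite addr_ge0 ?mulr_ge0.
  + apply: (le_trans (rabsD _ _)); rewrite rabsZ scalerDl addrACA.
    apply: rieszD => //; rewrite -scalerA -scalerDr.
    by apply: rieszZ.
- move=> y z [p [c [Pp p0 c0 yp]]] zy; exists p, c; split=> //.
  exact: le_trans yp.
Qed.

(** If [P] contains neither [x] nor [z], adjoining either one captures [y], so [|y| <= p + c |x|]
    and [|y| <= q + d |z|]. Then [|y| - (p + q)] lies below two disjoint elements, hence below [0],
    which puts [y] in [P]. *)
Lemma maximal_ideal_prime P y : is_ideal P -> ~ P y ->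
  (forall B, is_ideal B -> P `<=` B -> ~ B y -> B `<=` P) ->
  forall x z, rdisjoint x z -> P x \/ P z.
Proof.
move=> Pid Py Pmax.
have le_y x : ~ P x ->
    exists p c, [/\ P p, 0 <= p, 0 <= c & rabs y <= p + c *: rabs x].
  move=> Px; apply: contrapT => By; apply: Px.
  apply: (Pmax _ (is_ideal_adjoin x Pid) _ By) => [p Pp|].
    exists (rabs p), 0; rewrite rabs_ge0 scale0r addr0; split=> //.
    exact/is_ideal_rabs.
  exists 0, 1; rewrite !lexx ler01 scale1r add0r; split=> //.
  exact: Pid.1.1.
move=> x z xz; apply: contrapT => /not_orP[/le_y xP /le_y zP].
have [p [c [Pp p0 c0 yp]]] := xP; have [q [d [Pq q0 d0 yq]]] := zP.
apply: Py; apply: (is_ideal_le Pid (is_subspaceD Pid.1 Pp Pq)).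
rewrite -riesz_subr_ge0 -rieszN_le0 opprB.
apply: (@rmeet0_le _ _ (c *: rabs x) (d *: rabs z)).
- apply: rmeet0Z; rewrite ?rieszZ_ge0 ?rabs_ge0//.
  by rewrite rmeetC; apply: rmeet0Z; rewrite ?rabs_ge0// rmeetC.
- by rewrite rieszBlDr (le_trans yp)// addrC rieszD// riesz_lerDl.
- by rewrite rieszBlDr (le_trans yq)// addrC rieszD// riesz_lerDr.
Qed.

(** This is the ideal generated by all [(c y - u)^+]. These increase with [c], so one of them
    dominates a sum, and one constant can serve both as factor and as index. *)
Lemma is_ideal_excess u y : 0 <= y ->
  is_ideal [set z | exists2 c, 0 <= c & rabs z <= c *: rpos (c *: y - u)].
Proof.
move=> y0; split; first split.
- by exists 0; rewrite // scale0r ge0_rabs.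
- move=> a z t [c c0 zc] [d d0 td].
  have ac0 : 0 <= `|a| * c by rewrite mulr_ge0.
  (* The terms [|a| c] and [d] supply the factor; the extra [c] keeps the index at least [c] when
     [|a| < 1]. *)
  exists (`|a| * c + c + d); first by rewrite !addr_ge0.
  apply: (le_trans (rabsD _ _)); rewrite rabsZ.
  set e := `|a| * c + c + d; set r := rpos (e *: y - u).
  have le_r b : b <= e -> rpos (b *: y - u) <= r.
    by move=> be; apply/rpos_mono/rieszD => //; exact: rieszZr.
  have -> : e *: r = `|a| *: (c *: r) + d *: r + c *: r.
    by rewrite /e !scalerDl scalerA addrAC.
  apply: (@le_trans _ _ (`|a| *: (c *: r) + d *: r)); last first.
    by rewrite riesz_lerDl// rieszZ_ge0 ?rpos_ge0.
  apply: rieszD.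
    apply: rieszZ => //; apply: (le_trans zc); apply: rieszZ => //.
    by apply: le_r; rewrite /e -addrA addrCA lerDl addr_ge0.
  apply: (le_trans td); apply: rieszZ => //.
  by apply: le_r; rewrite /e lerDr addr_ge0.
- move=> z t [c c0 tc] zt; exists c => //; exact: le_trans tc.
Qed.

Lemma exists_functional x y : 0 <= y ->
  (forall c, 0 <= c -> ~ (y <= c *: rpos (c *: y - rabs x))) ->
  exists phi : {scalar E},
    disjointness_preserving phi /\ ~ order_bounded phi /\ phi x = 1.
Proof.
move=> y0 ynle; set J := [set z | exists2 c, 0 <= c &
  rabs z <= c *: rpos (c *: y - rabs x)].
have Jid : is_ideal J by exact: is_ideal_excess.
have Jy : ~ J y by move=> [c c0]; rewrite ge0_rabs//; exact: ynle.
have [P [JP Pid Py Pmax]] := maximal_avoiding is_ideal_bigcup Jid Jy.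
(* The witness [c + 1] makes the factor at least [1]. *)
have Pexc c : 0 <= c -> P (rpos (c *: y - rabs x)).
  move=> c0; apply: JP; exists (c + 1); first by rewrite addr_ge0.
  rewrite ge0_rabs ?rpos_ge0//.
  have cc : c <= c + 1 by rewrite lerDl.
  apply: (@le_trans _ _ (rpos ((c + 1) *: y - rabs x))).
    by apply/rpos_mono/rieszD => //; exact: rieszZr.
  by rewrite -[leLHS]scale1r rieszZr ?rpos_ge0// lerDr.
(* A functional vanishing on [P] and at [y - x] takes the same value at [x] and [y]; this value can
   be [1] once [x] is outside their span. *)
have Pyx : ~ adjoin P (y - x) x.
  move=> [t]; set p := x - t *: (y - x) => Pp.
  have px : (1 + t) *: x = p + t *: y.
    by rewrite /p scalerBr opprB scalerDl scale1r addrA subrK.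
  have [t1|t1] := eqVneq (1 + t) 0.
    apply: Py; move/eqP: t1; rewrite addrC addr_eq0 => /eqP t1.
    by move: Pp; rewrite /p t1 scaleN1r opprK addrC subrK.
  have s0 : 0 < `|1 + t| by rewrite normr_gt0.
  set s := `|1 + t| in s0; set c := s^-1 * `|t|.
  have c0 : 0 <= c by rewrite mulr_ge0// invr_ge0 ltW.
  have xle : rabs x <= s^-1 *: rabs p + c *: y.
    apply: (rieszZ_inv s0); rewrite scalerDr !scalerA mulrA mulfV ?gt_eqF//.
    rewrite scale1r mul1r -rabsZ px (le_trans (rabsD _ _))// rabsZ.
    by rewrite [rabs y]ge0_rabs.
  (* With [r] the positive part here, [(c + 1) y <= r + |x| <= r + s^-1 |p| + c y]. Cancelling [c y]
     puts [y] below an element of [P]. *)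
  have Pq : P (s^-1 *: rabs p + rpos ((c + 1) *: y - rabs x)).
    apply: Pid.1.2; first exact/is_ideal_rabs.
    by apply: Pexc; rewrite addr_ge0.
  apply: Py; apply: (is_ideal_le Pid Pq); rewrite ge0_rabs//.
  have := rpos_ge ((c + 1) *: y - rabs x); set r := rpos _.
  rewrite rieszBlDr => /le_trans /(_ (rieszD (lexx r) xle)).
  rewrite scalerDl scale1r addrA -rieszBlDr addrAC subrr add0r.
  by rewrite addrC.
have [phi [phix phi0]] :=
  exists_scalar_vanishing (is_subspace_adjoin (y - x) Pid.1) Pyx.
have phiP p : P p -> phi p = 0 by move=> Pp; apply: phi0; exact: adjoin_sub.
have phiy : phi y = 1.
  have := phi0 (y - x) (adjoin_mem _ Pid.1).
  by rewrite linearB phix => /eqP; rewrite subr_eq0 => /eqP.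
exists phi; split; last split=> //.
  move=> v w /(maximal_ideal_prime Pid Py Pmax)[/phiP ->|/phiP ->].
    by rewrite mul0r.
  by rewrite mulr0.
move=> /(_ 0 (rabs x))[M [_ /(_ (`|M| + 1))]].
rewrite (le_lt_trans (ler_norm M)) ?ltrDl// => /(_ isT).
(* The supposed bound on the values over [[0, |x|]] is [|M| + 1], so any larger value will do. *)
set t := `|M| + 2; have t0 : 0 <= t by rewrite addr_ge0.
have phit : phi (rmeet (t *: y) (rabs x)) = t.
  by rewrite rmeetE linearB linearZ (phiP _ (Pexc _ t0)) phiy subr0 /= mulr1.
move=> /(_ t); rewrite /= (ger0_norm t0); apply/not_implyP; split.
  exists (rmeet (t *: y) (rabs x)) => //.
  by rewrite /= in_itv/= rmeetP rmeet_ler rabs_ge0 rieszZ_ge0.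
by apply/negP; rewrite -ltNge ltrD2l ltr1n.
Qed.

End Ideal.

(** * The hyperarchimedean case: disjoint sequences in an infinite dimensional ideal *)

Section Hyperarchimedean.
Local Open Scope classical_set_scope.
Context {R : realType} {E : rieszType R}.
Set Implicit Arguments.
Unset Strict Implicit.
Implicit Types (u v w x y z : E) (a b c d : R).

(* Pointwise: every [y >= 0] is bounded below by a positive multiple of [u]
   wherever it does not vanish. *)
Definition hyperarchimedean u :=
  forall y, 0 <= y -> exists2 c, 0 <= c & y <= c *: rpos (c *: y - u).

Lemma hyperarchimedean_le u v :
  v <= u -> hyperarchimedean u -> hyperarchimedean v.
Proof.
move=> vu uH y /uH[c c0 yc]; exists c => //; apply: (le_trans yc).
by apply/rieszZ => //; apply/rpos_mono/rieszD; rewrite ?rieszN2.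
Qed.

(** This is the Archimedean property relative to [u]: the hypothesis gives [c w^+ <= u] for all
    [c >= 0], so the bound that [uH] puts on [w^+] vanishes. *)
Lemma hyperarchimedean_le0 u w : 0 <= u -> hyperarchimedean u ->
  (forall c, 0 < c -> w <= c *: u) -> w <= 0.
Proof.
move=> u0 uH wu; have [c c0 wc] := uH _ (rpos_ge0 w).
apply: (le_trans (rpos_ge w)); apply: (le_trans wc).
rewrite le0_rpos ?scaler0// rieszBlDr add0r -rposZ// rpos_le u0 andbT.
move: c0; rewrite le_eqVlt => /predU1P[<-|c0]; first by rewrite scale0r.
apply: (@rieszZ_inv _ _ c^-1); rewrite ?invr_gt0// scalerA mulVf ?gt_eqF//.
by rewrite scale1r wu// invr_gt0.
Qed.

(** If [0 <= y <= a (u + v)], then [y] is the sum of [y /\ a u] and [(y - a u)^+], which lie in the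
    two ideals. Thus when an infinite dimensional ideal is split, one of the halves is infinite
    dimensional. *)
Lemma finite_dimensional_principalD u v : 0 <= u -> 0 <= v ->
  finite_dimensional (principal_ideal u) ->
  finite_dimensional (principal_ideal v) ->
  finite_dimensional (principal_ideal (u + v)).
Proof.
move=> u0 v0 [m [e [eu uspan]]] [n [f [fv vspan]]].
have pos_span y a : 0 <= y -> 0 <= a -> y <= a *: (u + v) ->
    exists (c : 'I_m -> R) (d : 'I_n -> R),
      y = \sum_(i < m) c i *: e i + \sum_(i < n) d i *: f i.
  move=> y0 a0 yuv; have au0 : 0 <= a *: u by exact: rieszZ_ge0.
  have [|c yc] := uspan (rmeet y (a *: u)).
    by exists a; rewrite // ge0_rabs ?rmeet_ler// rmeetP y0.
  have [|d yd] := vspan (rpos (y - a *: u)).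
    exists a; rewrite // ge0_rabs ?rpos_ge0// rpos_le rieszZ_ge0// andbT.
    by rewrite rieszBlDr addrC -scalerDr.
  by exists c, d; rewrite -yc -yd rmeetE subrK.
exists (m + n)%N, (fun i : 'I_(m + n) =>
  match fintype.split i with inl j => e j | inr j => f j end).
split.
  move=> i; case: (fintype.split i) => j.
    have [a a0 ja] := eu j; exists a => //; apply: (le_trans ja).
    by apply: rieszZ => //; exact: riesz_lerDl.
  have [a a0 ja] := fv j; exists a => //; apply: (le_trans ja).
  by apply: rieszZ => //; exact: riesz_lerDr.
move=> y [a a0 ya].
have [c [d yE]] := pos_span _ _ (rpos_ge0 y) a0 (le_trans (rpos_le_rabs y) ya).
have [|c' [d' yE']] := pos_span _ _ (rpos_ge0 (- y)) a0.
  by apply: le_trans ya; rewrite -rabsN; exact: rpos_le_rabs.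
exists (fun i : 'I_(m + n) =>
  match fintype.split i with inl j => c j - c' j | inr j => d j - d' j end).
rewrite big_split_ord/= -[LHS]rposB yE yE' opprD addrACA -!sumrB.
congr (_ + _); apply: eq_bigr => i _.
  by rewrite (unsplitK (inl i)) scalerBl.
by rewrite (unsplitK (inr i)) scalerBl.
Qed.

(** Comparability makes [y] a Dedekind cut in the multiples of [v]; the Archimedean property
    identifies [y] with the supremum of the cut times [v]. *)
Lemma scalar_multiple_of_comparable v y : 0 <= v -> hyperarchimedean v ->
  principal_ideal v y -> (forall c, y <= c *: v \/ c *: v <= y) ->
  exists c, y = c *: v.
Proof.
move=> v0 vH [a a0]; rewrite rabs_le => /andP[ya ya'] ycomp.
(* For [v = 0] the cut would be all of [R] and have no supremum. *)
have [v_eq0|v_neq0] := eqVneq v 0.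
  exists 0; apply/le_anti; rewrite scale0r.
  by move: ya ya'; rewrite v_eq0 scaler0 rieszN_le0 => -> ->.
pose S : set R := [set c | c *: v <= y].
have Sub : ubound S a.
  move=> c; rewrite /S/= => cy; rewrite leNgt; apply/negP => ac.
  move/negP: v_neq0; apply; apply/eqP/le_anti; rewrite v0 andbT.
  apply: (@rieszZ_inv _ _ (c - a)); rewrite ?subr_gt0// scaler0 scalerBl.
  by rewrite rieszBlDr add0r (le_trans cy).
have Ssup : has_sup S.
  split; last by exists a.
  by exists (- a); rewrite /S/= scaleNr -rieszN2 opprK.
exists (sup S); apply/le_anti/andP; split;
  rewrite -[leRHS]add0r -rieszBlDr; apply: (hyperarchimedean_le0 v0 vH) => c c0.
- rewrite rieszBlDr -scalerDl; have [//|cS] := ycomp (c + sup S).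
  have : c + sup S <= sup S by apply: ub_le_sup => //; exists a.
  by rewrite gerDr leNgt c0.
- have [d dS sd] := sup_adherent c0 Ssup.
  rewrite rieszBlDr addrC -rieszBlDr -scalerBl (le_trans _ dS)//.
  by rewrite rieszZr// ltW.
Qed.

(** Some [y] in the ideal is not a multiple of [v], so it is incomparable with some [c v]. The
    positive and negative parts of [y - c v] are then nonzero and disjoint, and the support of the
    first one cuts [v] in two. *)
Lemma hyperarchimedean_split v : 0 <= v -> hyperarchimedean v ->
  ~ finite_dimensional (principal_ideal v) ->
  exists e f, [/\ v = e + f, 0 <= e, 0 <= f, rmeet e f = 0 & e <> 0 /\ f <> 0].
Proof.
move=> v0 vH vinf.
have [y [[l l0 yl] yv]] :
    exists y, principal_ideal v y /\ forall c, y <> c *: v.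
  apply: contrapT => h; apply: vinf; exists 1%N, (fun=> v); split=> [_|y vy].
    by exists 1; rewrite // ge0_rabs// scale1r.
  apply: contrapT => yv; apply: h; exists y; split=> // c yc; apply: yv.
  by exists (fun=> c); rewrite big_ord1.
have [c yc] : exists c, ~ (y <= c *: v \/ c *: v <= y).
  apply: contrapT => /forallNP h.
  have [||c /yv//] := @scalar_multiple_of_comparable v y v0 vH.
    by exists l.
  by move=> c; apply: contrapT; exact: h.
move/not_orP: yc => [yc cy].
set a := rpos (y - c *: v); set b := rpos (- (y - c *: v)).
have a_neq0 : a <> 0.
  move=> a0; apply: yc; rewrite -[leRHS]add0r -rieszBlDr -a0.
  exact: rpos_ge.
have b_neq0 : b <> 0.
  move=> b0; apply: cy; rewrite -[leRHS]add0r -rieszBlDr -b0.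
  by rewrite -[_ - y]opprB; exact: rpos_ge.
have ab : rmeet a b = 0 by exact: rpos_meetN.
have [a0 b0] : 0 <= a /\ 0 <= b by split; exact: rpos_ge0.
set m := l + `|c|; have m0 : 0 <= m by rewrite addr_ge0.
have ycm : rabs (y - c *: v) <= m *: v.
  apply: (le_trans (rabsD _ _)); rewrite rabsN rabsZ scalerDl.
  by apply: rieszD => //; rewrite ge0_rabs.
have am : a <= m *: v by apply: le_trans ycm; exact: rpos_le_rabs.
have bm : b <= m *: v.
  by apply: le_trans ycm; rewrite -rabsN; exact: rpos_le_rabs.
have [d d0 ad] := vH _ a0.
(* [a] vanishes wherever [d a < v], so [e] and [f] are the components of [v] on
   and off the support of [a]. *)
set f := rpos (v - d *: a); set e := rmeet v (d *: a).
have vE : v = e + f by rewrite /e rmeetE subrK.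
have f0 : 0 <= f by exact: rpos_ge0.
have da0 : 0 <= d *: a by exact: rieszZ_ge0.
have e0 : 0 <= e by rewrite rmeetP v0.
(* By [ad], [a] is below a multiple of [(d a - v)^+], which is disjoint from [f = (v - d a)^+]. *)
have fa : rmeet f a = 0.
  apply: (@rmeet0_sub _ _ f (d *: rpos (d *: a - v))) => //.
  apply: rmeet0Z => //; first exact: rpos_ge0.
  by rewrite -opprB; exact: rpos_meetN.
exists e, f; split=> //.
  rewrite rmeetC; apply: (@rmeet0_sub _ _ f (d *: a)) => //.
    exact: rmeet0Z.
  exact: rmeet_ler.
(* If [e = 0], then [v = f] is disjoint from [a], yet a multiple of [v] dominates [a]. If [f = 0],
   then [v <= d a], so a multiple of [a] dominates [b], which is disjoint from [a]. *)
split=> h.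
- apply: a_neq0; apply/le_anti; rewrite a0 andbT.
  apply: (@rmeet0_le _ _ a (m *: v)) => //; apply: rmeet0Z => //.
  by rewrite vE h add0r rmeetC.
- apply: b_neq0; apply/le_anti; rewrite b0 andbT.
  apply: (@rmeet0_le _ _ b (m *: (d *: a))) => //.
    by do 2?[apply: rmeet0Z => //]; rewrite rmeetC.
  apply: (le_trans bm); apply: rieszZ => //.
  by rewrite {1}vE h addr0 rmeet_ler.
Qed.

(** Each splitting keeps an infinite dimensional half [v n.+1] of [v n]; the discarded halves form
    the sequence. *)
Lemma hyperarchimedean_disjoint_sequence u : 0 <= u -> hyperarchimedean u ->
  ~ finite_dimensional (principal_ideal u) ->
  exists e : nat -> E, [/\ forall n, 0 <= e n, forall n, e n <= u,
    forall n, e n <> 0 & forall m n, m != n -> rmeet (e m) (e n) = 0].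
Proof.
move=> u0 uH uinf.
pose good v := [/\ 0 <= v, hyperarchimedean v &
  ~ finite_dimensional (principal_ideal v)].
have step v : exists w, good v ->
    [/\ good w, w <= v, v - w <> 0 & rmeet (v - w) w = 0].
  have [[v0 vH vinf]|] := pselect (good v); last by exists 0.
  have [e [f [vE e0 f0 ef [en0 fn0]]]] := hyperarchimedean_split v0 vH vinf.
  have [ev fv] : e <= v /\ f <= v.
    by rewrite vE; split; [exact: riesz_lerDl|exact: riesz_lerDr].
  have [efin|einf] := pselect (finite_dimensional (principal_ideal e)).
    exists f => _; rewrite {2 3}vE addrK; split=> //; split=> //.
      exact: hyperarchimedean_le vH.
    move=> ffin; apply: vinf; rewrite vE.
    exact: finite_dimensional_principalD.
  exists e => _; rewrite {2 3}vE addrC addKr rmeetC; split=> //; split=> //.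
  exact: hyperarchimedean_le vH.
have [F FP] := choice step.
pose v n := iter n F u.
have vgood n : good (v n) by elim: n => //= n /FP[].
have vS n : v n.+1 <= v n by have [] := FP _ (vgood n).
have v_anti m n : (m <= n)%N -> v n <= v m.
  elim: n => [|n IHn]; first by rewrite leqn0 => /eqP ->.
  by rewrite leq_eqVlt => /predU1P[->//|/IHn]; exact: le_trans.
have e0 n : 0 <= v n - v n.+1 by rewrite riesz_subr_ge0.
have ev n : v n - v n.+1 <= v n.
  by rewrite rieszBlDr riesz_lerDl//; have [] := vgood n.+1.
exists (fun n => v n - v n.+1); split=> //.
- by move=> n; apply: (le_trans (ev n)); exact: (v_anti 0%N).
- by move=> n; have [] := FP _ (vgood n).
(* The later piece lies below [v n], hence below [v m.+1], the half disjoint from the earlier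
   piece. *)
have lt_disj m n : (m < n)%N -> rmeet (v m - v m.+1) (v n - v n.+1) = 0.
  move=> mn; apply: (@rmeet0_sub _ _ (v m - v m.+1) (v m.+1)) => //.
    by have [] := FP _ (vgood m).
  by apply: (le_trans (ev n)); exact: v_anti.
move=> m n; rewrite neq_ltn => /orP[|]; first exact: lt_disj.
by rewrite rmeetC; exact: lt_disj.
Qed.

Lemma exists_geometric_le c : exists k, c * 2^-1 ^+ k <= 1.
Proof.
have [k ck] : exists k : nat, c < k%:R.
  exists (Num.bound `|c|); apply: (le_lt_trans (ler_norm c)).
  by rewrite archi_boundP.
exists k; rewrite exprVn ler_pdivrMr ?exprn_gt0// mul1r.
by rewrite (le_trans (ltW ck))// -natrX ler_nat ltnW// ltn_expl.
Qed.

Lemma hyperarchimedean_no_disjoint_sequence u (e : nat -> E) :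
  unif_complete E -> 0 <= u -> hyperarchimedean u ->
  (forall n, 0 <= e n) -> (forall n, e n <= u) -> (forall n, e n <> 0) ->
  (forall m n, m != n -> rmeet (e m) (e n) = 0) -> False.
Proof.
move=> Ecomp u0 uH e0 eu en0 edisj.
pose h k : R := 2^-1 ^+ k.
have h0 k : 0 < h k by rewrite exprn_gt0// invr_gt0.
have hS k : h k = h k.+1 + h k.+1.
  by rewrite [LHS]splitr /h exprS mulrC.
pose s n := \sum_(i < n) h i *: e i.
have s_mono m n : (m <= n)%N -> s m <= s n.
  apply: (homo_leq _ _ (r := fun x y : E => x <= y)) => //.
    by move=> ? ? ?; exact: le_trans.
  by move=> i; rewrite /s big_ord_recr riesz_lerDl//= rieszZ_ge0// ltW.
(* The tail [\sum_(i >= n) 2^-i] is [h n + h n]; adding it times [u] turns the increasing partial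
   sums into decreasing upper bounds. *)
have t_anti m n : (m <= n)%N ->
    s n + (h n + h n) *: u <= s m + (h m + h m) *: u.
  apply: (homo_leq _ _ (r := fun x y : E => y <= x)
    (f := fun n => s n + (h n + h n) *: u)) => //.
    by move=> ? ? ? + ?; apply: le_trans.
  move=> i; rewrite {1}/s big_ord_recr/= -hS scalerDl -addrA.
  by apply: rieszD => //; apply: rieszD => //; apply: rieszZ => //; exact: ltW.
have s_le m n : (m <= n)%N -> s n <= s m + (h m + h m) *: u.
  move=> mn; apply: le_trans (t_anti _ _ mn).
  by rewrite riesz_lerDl// rieszZ_ge0// addr_ge0// ltW.
have s_cauchy : unif_cauchy u s.
  move=> d d0; have [N hN] := exists_geometric_le (2 / d).
  have hNd : h N + h N <= d.
    move: hN; rewrite -/(h N) mulrAC ler_pdivrMr// mul1r.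
    by rewrite mulr_natl mulr2n.
  suff sN m n : (N <= m)%N -> (N <= n)%N -> s m - s n <= d *: u.
    by exists N => m n Nm Nn; rewrite rabs_le opprB !sN.
  move=> Nm Nn; rewrite rieszBlDr; apply: (le_trans (s_le _ _ Nm)).
  by rewrite addrC; apply: rieszD; [exact: rieszZr|exact: s_mono].
have [g sg] := Ecomp u u0 s s_cauchy.
have sE k n : (k < n)%N -> exists t, [/\ s n = h k *: e k + t, 0 <= t &
    rmeet (e k) t = 0].
  move=> kn; set t := \sum_(i < n | i != Ordinal kn) h i *: e i.
  have [t0 et] : 0 <= t /\ rmeet (e k) t = 0.
    apply: (big_ind (fun z => 0 <= z /\ rmeet (e k) z = 0)).
    - by split=> //; apply: rmeet_eq0P.
    - move=> x y [x0 ex] [y0 ey].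
      by split; [exact: riesz_addr_ge0|exact: rmeet0D].
    - move=> i ik; have hi0 := ltW (h0 i); split; first exact: rieszZ_ge0.
      by apply: rmeet0Z => //; apply: edisj; rewrite eq_sym.
  by exists t; split=> //; rewrite /s (bigD1 (Ordinal kn)).
have g_ge k : h k *: e k <= g.
  rewrite -[leRHS]add0r -rieszBlDr; apply: (hyperarchimedean_le0 u0 uH) => d d0.
  have [N gN] := sg d d0; set n := maxn N k.+1.
  have := gN n (leq_maxl _ _); rewrite rabs_le => /andP[+ _].
  apply: le_trans; apply: rieszD => //.
  have [t [-> t0 _]] := sE k n (leq_maxr _ _).
  exact: riesz_lerDl.
(* Up to [d u], the difference is below the sum [t] of the terms other than the [k]-th, which is
   disjoint from [e k]. So a common lower bound [w] is at most [d u] for every [d > 0]. *)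
have g_disj k : rmeet (e k) (g - h k *: e k) = 0.
  apply: rmeet_eq0P => //; first by rewrite riesz_subr_ge0.
  move=> w w0 we wg; apply: (hyperarchimedean_le0 u0 uH) => d d0.
  have [N gN] := sg d d0; set n := maxn N k.+1.
  have := gN n (leq_maxl _ _); rewrite rabs_le opprB => /andP[_].
  have [t [-> t0 et]] := sE k n (leq_maxr _ _).
  rewrite rieszBlDr => gt; apply: (rmeet0_leD et) => //.
    by rewrite rieszZ_ge0// ltW.
  by apply: (le_trans wg); rewrite rieszBlDr (le_trans gt)// addrAC addrC
    [t + _]addrC.
have g0 : 0 <= g by apply: le_trans (g_ge 0%N); rewrite rieszZ_ge0// ltW.
have [c c0 gc] := uH g g0.
(* As [c h_k e_k <= e_k <= u], the element [c g - u] is at most [c z] with [z = g - h_k e_k]. Hence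
   [h_k e_k <= g <= c (c z)], while [z] is disjoint from [e_k]; this forces [e_k = 0]. *)
have [k ck] := exists_geometric_le c; rewrite -/(h k) in ck.
apply: (en0 k); apply/le_anti; rewrite e0 andbT.
set z := g - h k *: e k.
have z0 : 0 <= z by rewrite riesz_subr_ge0.
apply: (@rmeet0_le _ _ (e k) ((h k)^-1 *: (c *: (c *: z)))) => //.
  by do 3?[apply: rmeet0Z; rewrite ?rieszZ_ge0 ?invr_ge0 ?(ltW (h0 k))//].
apply: (rieszZ_inv (h0 k)); rewrite [leRHS]scalerA mulfV ?gt_eqF// scale1r.
apply: (le_trans (g_ge k)); apply: (le_trans gc); apply: rieszZ => //.
rewrite rpos_le rieszZ_ge0// andbT rieszBlDr.
rewrite -[g in leLHS](subrK (h k *: e k)) scalerDr -/z.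
apply: rieszD => //; rewrite scalerA; apply: le_trans (eu k).
by rewrite -[leRHS]scale1r rieszZr.
Qed.

End Hyperarchimedean.

Theorem theorem2p3 (R : realType) (E : rieszType R)
    (Ecomplete : unif_complete E) (x : E)
    (xinf : ~ finite_dimensional (principal_ideal (rabs x))) :
  exists phi : {scalar E},
    disjointness_preserving phi /\ ~ order_bounded phi /\ phi x = 1.
Proof.
have u0 := rabs_ge0 x.
have [uH|/existsNP[y /not_implyP[y0 yc]]] :=
  pselect (hyperarchimedean (rabs x)).
  have [e [e0 eu en0 edisj]] := hyperarchimedean_disjoint_sequence u0 uH xinf.
  by case: (hyperarchimedean_no_disjoint_sequence Ecomplete u0 uH e0 eu en0).
by apply: (exists_functional y0) => c c0 h; apply: yc; exists c.
Qed.
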